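(* Let $\mathcal{B}$ be the Borel $\sigma$-algebra on $\mathbb{R}$ and $\nu$ the Lebesgue measure on $\mathcal{B}$. There exist a measure space $(X,\mathcal{A},\mu)$, a product measure $\mu\times\nu$ of $\mu$ and $\nu$ on $\mathcal{A}\otimes\mathcal{B}$ (in the sense defined in the context), a real number $c\in\mathbb{R}$, and a measurable set $E\in\mathcal{A}\otimes\mathcal{B}$ such that $$(\mu\times\nu)(E)\neq(\mu\times\nu)(E+c),$$ where $E+c=\{(x,y+c):(x,y)\in E\}$ is the vertical shift of $E$ by $c$.
   Context: For a measure space $(X,\mathcal{A},\mu)$ (not assumed $\sigma$-finite) and $(\mathbb{R},\mathcal{B},\nu)$, where $\mathcal{B}$ is the Borel $\sigma$-algebra and $\nu$ is Lebesgue measure on it, $\mathcal{A}\otimes\mathcal{B}$ denotes the product $\sigma$-algebra on $X\times\mathbb{R}$, i.e. the $\sigma$-algebra generated by the measurable rectangles $A\times B$ with $A\in\mathcal{A}$ and $B\in\mathcal{B}$. A set function $\mu\times\nu:\mathcal{A}\otimes\mathcal{B}\to[0,\infty]$ is called a product measure of $\mu$ and $\nu$ if it is a measure on $\mathcal{A}\otimes\mathcal{B}$ and $(\mu\times\nu)(A\times B)=\mu(A)\nu(B)$ for all $A\in\mathcal{A}$ and $B\in\mathcal{B}$, with the convention $0\cdot\infty=\infty\cdot 0=0$. Such a measure need not be unique; the notation $\mu\times\nu$ stands for any measure with this property, not a specific construction. For $E\in\mathcal{A}\otimes\mathcal{B}$ and $c\in\mathbb{R}$, the vertical shift of $E$ by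 $c$ is $E+c=\{(x,y+c):(x,y)\in E\}$, which belongs to $\mathcal{A}\otimes\mathcal{B}$. *)

(* Defs.v *)
From HB Require Import structures.
From mathcomp Require Import all_boot all_order all_algebra.
From mathcomp Require Import all_classical all_reals all_analysis.
From mathcomp Require Import measurable_realfun.
Import Order.TTheory GRing.Theory Num.Theory numFieldNormedType.Exports.

Set Implicit Arguments.
Unset Strict Implicit.
Unset Printing Implicit Defensive.

Local Open Scope classical_set_scope.
Local Open Scope ring_scope.

(* [T1 * T2] carries the product sigma-algebra, generated by the measurable
   rectangles ([measurable_prod_measurableType]). In [\bar R],
   [0 * +oo = +oo * 0 = 0]. *)
Definition is_product_measure (d1 d2 : measure_display)
    (T1 : measurableType d1) (T2 : measurableType d2) (R : realType)
    (mu : {measure set T1 -> \bar R}) (nu : {measure set T2 -> \bar R})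
    (rho : {measure set (T1 * T2)%type -> \bar R}) : Prop :=
  forall (A : set T1) (B : set T2), measurable A -> measurable B ->
    rho (A `*` B) = (mu A * nu B)%E.

(* [measurableTypeR R] is [R] with its Borel sigma-algebra. *)
Definition vshift (d : measure_display) (X : measurableType d) (R : realType)
    (c : R) (E : set (X * measurableTypeR R)) : set (X * measurableTypeR R) :=
  [set (p.1, (p.2 : R) + c) | p in E].

(* Measures are functions on all subsets, with no meaning outside the
   sigma-algebra, hence this check that the shifted set stays in it. *)
Lemma measurable_vshift (d : measure_display) (X : measurableType d)
    (R : realType) (c : R) (E : set (X * measurableTypeR R)) :
  measurable E -> measurable (vshift c E).
Proof.
move=> mE.
pose f (p : X * measurableTypeR R) : X * measurableTypeR R :=
  (p.1, (p.2 : R) - c).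
have -> : vshift c E = f @^-1` E.
  apply/seteqP; split => [_ [[x y] Exy <-]|[x y] Exy] /=.
    by rewrite /f /= addrK.
  by exists (x, (y : R) - c) => //=; rewrite subrK.
rewrite -[X in measurable X]setTI.
apply: (_ : measurable_fun setT f) => //.
apply: measurable_fun_pair; first exact: measurable_fst.
apply: (@measurable_funB _ _ R setT snd (cst c)) => //.
Qed.

(* Main.v *)
Require Import Defs.
From HB Require Import structures.
From mathcomp Require Import all_boot all_order all_algebra.
From mathcomp Require Import all_classical all_reals all_analysis.
From mathcomp Require Import measurable_realfun.
Import Order.TTheory GRing.Theory Num.Theory numFieldNormedType.Exports.

Local Open Scope classical_set_scope.
Local Open Scope ring_scope.

(** A product measure is pinned down on rectangles only, and when [mu] is as far
    from sigma-finite as possible this leaves room for a part that is attached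
    to a curve and does not move with the sets. Take [X] to be the line with its
    Borel sets, and let [mu] be infinite on every nonempty set
    ([nonempty_measure]). A product measure of [mu] and Lebesgue measure [nu]
    must then give [A `*` B] mass [+oo] if [A] is nonempty and [nu B > 0], and
    mass [0] otherwise. One solution is the measure that is [0] on the sets all
    of whose vertical sections are [nu]-null, and [+oo] on the others
    ([sections_measure]). Adding to it the image of [nu] under [x |-> (x, x)]
    gives another one ([sections_diag_measure_is_product]): this image gives
    [A `*` B] mass [nu (A `&` B) <= nu B], so it vanishes on the rectangles
    where the total must be [0] and is absorbed by [+oo] on the others.

    The two summands are told apart by the diagonal. Its vertical sections, and
    those of its shifts, are single points, so the first summand vanishes on all
    of them; the second gives the diagonal mass [nu setT = +oo], and any
    nonzero shift of it mass [0], as that shift is disjoint from the diagonal. *)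

(** * Measures with values zero and infinity *)

Section null_infty_measure.
Context {d : measure_display} {T : measurableType d} (R : realType).
Variable N : set (set T).
Hypothesis N0 : N set0.
(** The two directions are the sigma-ideal axioms that additivity needs:
    stability under countable unions and, for the converse, stability under
    passing from a union to its members. *)
Hypothesis Nbigcup : forall F : (set T)^nat, (forall n, measurable (F n)) ->
  N (\bigcup_n F n) <-> forall n, N (F n).

Definition null_infty (A : set T) : \bar R := if `[< N A >] then 0%E else +oo%E.

Lemma null_infty_null A : N A -> null_infty A = 0%E.
Proof. by move=> NA; rewrite /null_infty asboolT. Qed.

Lemma null_infty_pinfty A : ~ N A -> null_infty A = +oo%E.
Proof. by move=> NA; rewrite /null_infty asboolF. Qed.

Lemma null_infty_ge0 A : (0 <= null_infty A)%E.
Proof. by rewrite /null_infty; case: ifP. Qed.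

(** If every [F n] lies in [N], so does the union, and all the partial sums are
    [0]. Otherwise the union is outside [N], and some term of the series is
    [+oo]. *)
Lemma null_infty_sigma_additive : semi_sigma_additive null_infty.
Proof.
move=> F mF _ _.
have [NF|/existsNP[k NFk]] := pselect (forall n, N (F n)).
  rewrite null_infty_null; last exact/Nbigcup.
  apply: cvg_near_cst; apply: nearW => n.
  by rewrite big1// => i _; rewrite null_infty_null.
rewrite null_infty_pinfty; last by move/Nbigcup => /(_ mF k).
rewrite -(@nneseries_pinfty _ (null_infty \o F) xpredT k)//=; last 2 first.
  by move=> n _; exact: null_infty_ge0.
  exact: null_infty_pinfty.
by apply: is_cvg_nneseries => n _ _; exact: null_infty_ge0.
Qed.

Definition null_infty_measure : {measure set T -> \bar R} :=
  HB.pack null_infty (isMeasure.Build d T R null_infty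
    (null_infty_null _ N0) null_infty_ge0 null_infty_sigma_additive).

End null_infty_measure.

Lemma measure_bigcup_eq0 {d : measure_display} {T : measurableType d}
    {R : realType} (m : {measure set T -> \bar R}) (F : (set T)^nat) :
  (forall n, measurable (F n)) ->
  m (\bigcup_n F n) = 0%E <-> forall n, m (F n) = 0%E.
Proof.
move=> mF; have mUF : measurable (\bigcup_n F n) by exact: bigcupT_measurable.
split => [F0 n|F0].
  exact: (subset_measure0 (mF n) mUF (bigcup_sup _) F0).
apply/negligibleP => //; apply: negligible_bigcup => n.
by apply/negligibleP => //; exact: F0.
Qed.

(** The ideal is that of the empty set alone, so this is [+oo] times the
    counting measure. *)
Definition nonempty_measure {d : measure_display} (T : measurableType d)
  (R : realType) : {measure set T -> \bar R}.
Proof.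
refine (@null_infty_measure _ T R (fun A => A = set0) erefl _).
by move=> F _; split => [/bigcup0P F0 n|F0]; [exact: F0 | exact: bigcup0].
Defined.

(** * Two product measures *)

Section sections_measure.
Context {d1 d2 : measure_display} {T1 : measurableType d1}
  {T2 : measurableType d2} {R : realType} (m : {measure set T2 -> \bar R}).

Definition null_sections (E : set (T1 * T2)) := forall x, m (xsection E x) = 0%E.

(** This is the product of [nonempty_measure] and [m] that is obtained by summing
    [+oo * m (xsection E x)] over all [x]. *)
Definition sections_measure : {measure set (T1 * T2)%type -> \bar R}.
Proof.
refine (@null_infty_measure _ (T1 * T2)%type R null_sections _ _).
  by move=> x; rewrite xsection0 measure0.
move=> F mF; have mFx n x : measurable (xsection (F n) x).
  exact: measurable_xsection.
split => [F0 n x|F0 x].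
  by move: (F0 x); rewrite xsection_bigcup =>
    /measure_bigcup_eq0 -/(_ (mFx^~ x)).
by rewrite xsection_bigcup; apply/measure_bigcup_eq0 => n;
  [exact: mFx|exact: F0].
Defined.

Lemma null_sectionsX (A : set T1) (B : set T2) :
  null_sections (A `*` B) <-> A = set0 \/ m B = 0%E.
Proof.
split=> [AB0|[->|B0] x].
- have [->|/set0P[x Ax]] := eqVneq A set0; first by left.
  by right; rewrite -(AB0 x) in_xsectionX// inE.
- by rewrite set0X xsection0 measure0.
- have [xA|xA] := boolP (x \in A); first by rewrite in_xsectionX.
  by rewrite notin_xsectionX ?measure0.
Qed.

End sections_measure.

Section sections_diag_measure.
Context {d : measure_display} {T : measurableType d} {R : realType}
  (m : {measure set T -> \bar R}).

Definition diag_measure : {measure set (T * T)%type -> \bar R}.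
Proof.
refine (pushforward m (fun x : T => (x, x))).
by apply: measurable_fun_pair; exact: measurable_id.
Defined.

Definition sections_diag_measure : {measure set (T * T)%type -> \bar R} :=
  measure_add (sections_measure m) diag_measure.

Lemma sections_diag_measureE E :
  sections_diag_measure E =
  (null_infty R (null_sections m) E + m [set x | E (x, x)])%E.
Proof. exact: measure_addE. Qed.

(** The diagonal part of [A `*` B] is [m (A `&` B)]. It is [0] when [A] is empty
    or [m B = 0], which are the cases where the product must vanish; in all the
    other cases [sections_measure] is already [+oo]. *)
Lemma sections_diag_measure_is_product :
  is_product_measure (nonempty_measure T R) m sections_diag_measure.
Proof.
move=> A B mA mB; rewrite sections_diag_measureE.
rewrite (_ : [set x | (A `*` B) (x, x)] = A `&` B)//.
have [->|A0] := eqVneq A set0.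
  rewrite measure0 mul0e set0I measure0 adde0 null_infty_null//.
  by apply/null_sectionsX; left.
have mA_oo : nonempty_measure T R A = +oo%E.
  by apply: null_infty_pinfty; exact/eqP.
have [B0|B0] := eqVneq (m B) 0%E.
  rewrite B0 mule0 null_infty_null; last by apply/null_sectionsX; right.
  rewrite add0e.
  by apply: (subset_measure0 _ mB _ B0); [exact: measurableI|exact: subIsetr].
rewrite mA_oo null_infty_pinfty; last first.
  by move=> /null_sectionsX[|]; exact/eqP.
rewrite gt0_mulye; last by rewrite lt0e B0 measure_ge0.
by rewrite addye// gt_eqF// (lt_le_trans ltNy0).
Qed.

End sections_diag_measure.

(** * Shifting the diagonal of the plane *)

Section diagonal.
Context {R : realType}.
Local Notation rT := (measurableTypeR R).

Definition diagonal : set (rT * rT) := [set p | p.1 = p.2].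

Lemma measurable_diagonal : measurable diagonal.
Proof.
have -> : diagonal = (fun p : rT * rT => (p.1 : R) - p.2) @^-1` [set 0].
  apply/seteqP; split => [p /= ->|p /=]; first by rewrite subrr.
  by move=> /eqP; rewrite subr_eq0 => /eqP.
rewrite -[X in measurable X]setTI.
apply: (_ : measurable_fun setT _) => //.
by apply: (@measurable_funB _ _ R setT fst snd).
Qed.

(** Each section is a single point, and [sections_measure lebesgue_measure]
    therefore does not see the diagonal or its shifts. *)
Lemma null_sections_vshift_diagonal c :
  null_sections lebesgue_measure (vshift c diagonal).
Proof.
move=> x; rewrite (_ : xsection _ x = [set (x : R) + c]).
  exact: lebesgue_measure_set1.
apply/seteqP; split => y; rewrite xsectionE /=.
  move=> [[u v]]; rewrite /diagonal /= => -> [<- <-] //.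
by move=> ->; exists (x, x).
Qed.

Lemma vshift0 (E : set (rT * rT)) : vshift 0 E = E.
Proof.
apply/seteqP; split => [_ [[x y] Exy <-]|[x y] Exy] /=; first by rewrite addr0.
by exists (x, y) => //=; rewrite addr0.
Qed.

(** All the mass comes from the diagonal part, which is that of the whole line. *)
Lemma sections_diag_measure_diagonal :
  sections_diag_measure lebesgue_measure diagonal = +oo%E.
Proof.
rewrite sections_diag_measureE null_infty_null; last first.
  by rewrite -[diagonal]vshift0; exact: null_sections_vshift_diagonal.
rewrite add0e (_ : [set x | diagonal (x, x)] = [set` `]-oo, +oo[]).
  exact: (lebesgue_measure_itv `]-oo, +oo[).
by rewrite set_itvE; apply/seteqP; split.
Qed.

(** The line [y = x + c] does not meet the diagonal, so the diagonal part
    vanishes too. *)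
Lemma sections_diag_measure_vshift_diagonal (c : R) : c != 0 ->
  sections_diag_measure lebesgue_measure (vshift c diagonal) = 0%E.
Proof.
move=> c0; rewrite sections_diag_measureE null_infty_null; last first.
  exact: null_sections_vshift_diagonal.
rewrite add0e (_ : [set x | _] = set0) ?measure0//.
apply/seteqP; split => // x [[u v]]; rewrite /diagonal /= => -> [->].
by move=> /eqP; rewrite -subr_eq0 addrAC subrr add0r (negbTE c0).
Qed.

End diagonal.

Theorem mainTheorem1 (R : realType) :
  exists (d : measure_display) (X : measurableType d)
    (mu : {measure set X -> \bar R})
    (rho : {measure set (X * measurableTypeR R)%type -> \bar R})
    (c : R) (E : set (X * measurableTypeR R)),
    [/\ is_product_measure mu (@lebesgue_measure R) rho,
        measurable E &
        rho E <> rho (vshift c E)].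
Proof.
exists _, (measurableTypeR R), (nonempty_measure _ R).
exists (sections_diag_measure lebesgue_measure), 1, diagonal; split.
- exact: sections_diag_measure_is_product.
- exact: measurable_diagonal.
- by rewrite sections_diag_measure_diagonal
    sections_diag_measure_vshift_diagonal ?oner_neq0.
Qed.
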